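(* Let $N\ge1$, let $\Omega\subset\mathbb{R}^N$ be a bounded domain with Lipschitz boundary, let $p>1$, $s\in(0,1)$, $f\in L^{p'}(\Omega)$ and $g\in L^1(\mathbb{R}^N\setminus\overline\Omega)$. Let $u\in X$ be a weak solution of $$\begin{cases}(-\Delta)^s_p u=f&\text{in }\Omega,\\ \mathscr{N}_{s,p}u=g&\text{in }\mathbb{R}^N\setminus\overline\Omega.\end{cases}$$ Then $\mathscr{N}_{s,p}u=g$ a.e. in $\mathbb{R}^N\setminus\overline\Omega$.
   Context: Write $C\Omega=\mathbb{R}^N\setminus\Omega$, $p'=p/(p-1)$ and $J_p(\tau)=|\tau|^{p-2}\tau$. Here $(-\Delta)^s_p u(x)=\mathrm{PV}\int_{\mathbb{R}^N}\frac{J_p(u(x)-u(y))}{|x-y|^{N+ps}}\,dy$ and $\mathscr{N}_{s,p}u(x)=\int_\Omega\frac{J_p(u(x)-u(y))}{|x-y|^{N+ps}}\,dy$ for $x\in\mathbb{R}^N\setminus\overline\Omega$ (normalizing constant set equal to $1$). The space $X$ (depending on $g$) consists of all measurable $u:\mathbb{R}^N\to\mathbb{R}$ with $$\|u\|_X^p=\|u\|_{L^p(\Omega)}^p+\big\||g|^{1/p}u\big\|_{L^p(\mathbb{R}^N\setminus\Omega)}^p+\int_{\mathbb{R}^{2N}\setminus(C\Omega)^2}\frac{|u(x)-u(y)|^p}{|x-y|^{N+ps}}\,dx\,dy<\infty$$ (since $\partial\Omega$ has measure zero, $\mathbb{R}^N\setminus\Omega$ and $\mathbb{R}^N\setminus\overline\Omega$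 are interchangeable in integrals). A function $u\in X$ is a weak solution of the problem if for every $v\in X$ $$\frac12\int_{\mathbb{R}^{2N}\setminus(C\Omega)^2}\frac{J_p(u(x)-u(y))(v(x)-v(y))}{|x-y|^{N+ps}}\,dx\,dy=\int_\Omega fv\,dx+\int_{\mathbb{R}^N\setminus\overline\Omega}gv\,dx .$$ *)

(* Defs.v *)
From HB Require Import structures.
From mathcomp Require Import all_boot all_order all_algebra.
From mathcomp Require Import all_classical all_reals all_analysis.
Set Implicit Arguments.
Unset Strict Implicit.
Unset Printing Implicit Defensive.
Import Order.TTheory GRing.Theory Num.Theory.
Import numFieldNormedType.Exports.

Local Open Scope classical_set_scope.
Local Open Scope ring_scope.

(* R^N with the product sigma-algebra of the Borel sigma-algebra of R; only
   used to construct the Lebesgue measure on R^N. *)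
Definition borelRn (R : realType) (N : nat) : Type := 'rV[R]_N.

Definition borelRn_display : measure_display.
Proof. exact: (measure_tuple_display default_measure_display). Qed.

Section borelRn.
Context (R : realType) (N : nat).

HB.instance Definition _ := Pointed.copy (borelRn R N) 'rV[R]_N.

Definition coordRn (i : 'I_N) (x : borelRn R N) : R := x ord0 i.

Let borelRn_set0 : g_sigma_preimage coordRn set0.
Proof. exact: sigma_algebra0. Qed.

Let borelRn_setC A : g_sigma_preimage coordRn A -> g_sigma_preimage coordRn (~` A).
Proof. exact: sigma_algebraC. Qed.

Let borelRn_bigcup (F : (set (borelRn R N))^nat) :
  (forall i, g_sigma_preimage coordRn (F i)) ->
  g_sigma_preimage coordRn (\bigcup_i (F i)).
Proof. exact: sigma_algebra_bigcup. Qed.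

HB.instance Definition _ := @isMeasurable.Build borelRn_display
  (borelRn R N) (g_sigma_preimage coordRn)
  borelRn_set0 borelRn_setC borelRn_bigcup.

End borelRn.

Section borel_lebesgue.
Context (R : realType).

Lemma measurable_coordRn N (i : 'I_N) :
  measurable_fun [set: borelRn R N] (@coordRn R N i).
Proof.
move=> _ Y mY; rewrite setTI; apply: sub_sigma_algebra => /=.
rewrite -bigcup_seq/=; exists i => /=; first by rewrite mem_index_enum.
by exists Y => //; rewrite setTI.
Qed.

Definition consRn N (z : R * borelRn R N) : borelRn R N.+1 :=
  row_mx (z.1%:M : 'M[R]_1) (z.2 : 'rV[R]_N).

Definition unconsRn N (x : borelRn R N.+1) : R * borelRn R N :=
  (coordRn ord0 x, \row_(i < N) x ord0 (lift ord0 i)).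

Lemma consRn_ord0 N (z : R * borelRn R N) : coordRn ord0 (consRn z) = z.1.
Proof.
rewrite /coordRn (_ : ord0 = lshift N (ord0 : 'I_1)); last exact/val_inj.
by apply: etrans (row_mxEl _ _ _ _) _; rewrite mxE eqxx mulr1n.
Qed.

Lemma consRn_lift N (z : R * borelRn R N) (i : 'I_N) :
  coordRn (lift ord0 i) (consRn z) = coordRn i z.2.
Proof.
rewrite /coordRn (_ : lift ord0 i = rshift 1 i :> 'I_(1 + N)); last first.
  exact/val_inj.
exact: row_mxEr.
Qed.

Lemma consRnK N : cancel (@consRn N) (@unconsRn N).
Proof.
move=> [a x]; congr pair; first exact: consRn_ord0.
by apply/rowP => i; rewrite mxE; exact: consRn_lift.
Qed.

Lemma measurable_borelRnP d (T : measurableType d) N (f : T -> borelRn R N) :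
  (forall i, measurable_fun setT (coordRn i \o f)) -> measurable_fun setT f.
Proof.
move=> mf; apply: (@measurability _ _ _ _ _ _
  (\big[setU/set0]_(i < N) preimage_set_system setT (@coordRn R N i) measurable)).
  by [].
move=> _ [B + <-]; rewrite -bigcup_seq => -[i _ [A mA <-]].
by rewrite !setTI -comp_preimage -[X in measurable X]setTI; exact: mf.
Qed.

Lemma measurable_consRn N : measurable_fun setT (@consRn N).
Proof.
apply: measurable_borelRnP => i; have [j ->|->] := unliftP ord0 i.
  rewrite (_ : _ \o _ = coordRn j \o snd); last first.
    by apply/funext => z; exact: consRn_lift.
  exact: (measurableT_comp (@measurable_coordRn N j) measurable_snd).
by rewrite (_ : _ \o _ = fst)//; apply/funext => z; exact: consRn_ord0.
Qed.

Lemma measurable_unconsRn N : measurable_fun setT (@unconsRn N).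
Proof.
apply: measurable_fun_pair; first exact: measurable_coordRn.
apply: measurable_borelRnP => i.
rewrite (_ : _ \o _ = @coordRn R N.+1 (lift ord0 i)).
  exact: measurable_coordRn.
by apply/funext => x; rewrite /coordRn /= mxE.
Qed.

Section lebesgue_cons.
Context (N : nat) (mu : {sigma_finite_measure set (borelRn R N) -> \bar R}).

Definition lebesgue_cons : set (borelRn R N.+1) -> \bar R :=
  pushforward (lebesgue_measure \x mu)%E (@consRn N).

HB.instance Definition _ := Measure.copy lebesgue_cons
  (measure_function_pushforward__canonical__measure_function_Measure
     (lebesgue_measure \x mu)%E (@measurable_consRn N)).

Let lebesgue_cons_sigma_finite : sigma_finite setT lebesgue_cons.
Proof.
have /sigma_finiteP[F [TF ndF Foo]] := sigma_finiteT (@lebesgue_measure R).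
have /sigma_finiteP[G [TG ndG Goo]] := sigma_finiteT mu.
exists (fun n => @unconsRn N @^-1` (F n `*` G n)).
  apply/esym/seteqP; split=> // x _.
  have : (\bigcup_n F n) (unconsRn x).1 by rewrite -TF.
  have : (\bigcup_n G n) (unconsRn x).2 by rewrite -TG.
  move=> [k _ Gk] [n _ Fn]; exists (maxn n k) => //; split.
  - by move: Fn; exact/subsetPset/ndF/leq_maxl.
  - by move: Gk; exact/subsetPset/ndG/leq_maxr.
move=> n; have [mF Fn] := Foo n; have [mG Gn] := Goo n; split.
  rewrite -[X in measurable X]setTI; apply: measurable_unconsRn => //.
  exact: measurableX.
rewrite /lebesgue_cons /pushforward -comp_preimage.
rewrite (_ : _ \o _ = id); last by apply/funext => z; exact: consRnK.
by rewrite preimage_id product_measure1E// lte_mul_pinfty// ge0_fin_numE.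
Qed.

HB.instance Definition _ := @Measure_isSigmaFinite.Build _ _ _ lebesgue_cons
  lebesgue_cons_sigma_finite.

End lebesgue_cons.

Fixpoint borel_lebesgue N : {sigma_finite_measure set (borelRn R N) -> \bar R} :=
  if N is n.+1 then lebesgue_cons (borel_lebesgue n)
  else \d_(point : borelRn R 0).

End borel_lebesgue.

(* R^N with the topology of 'rV[R]_N and the sigma-algebra of Lebesgue
   measurable sets. *)
Definition Rn (R : realType) (N : nat) : Type := 'rV[R]_N.

Section Rn.
Context (R : realType) (N : nat).

HB.instance Definition _ := NormedModule.copy (Rn R N) 'rV[R]_N.
HB.instance Definition _ := Measurable.copy (Rn R N)
  (caratheodory_type (borel_lebesgue R N)^*%mu).

Definition lebesgue_Rn : set (Rn R N) -> \bar R :=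
  @completed_measure_extension _ _ _ (borel_lebesgue R N).

HB.instance Definition _ := Measure.copy lebesgue_Rn
  (@completed_measure_extension _ _ _ (borel_lebesgue R N)).

Let lebesgue_Rn_sigma_finite : sigma_finite setT lebesgue_Rn.
Proof.
exact: (completed_measure_extension_sigma_finite (sigma_finiteT (borel_lebesgue R N))).
Qed.

HB.instance Definition _ := @Measure_isSigmaFinite.Build _ _ _ lebesgue_Rn
  lebesgue_Rn_sigma_finite.

End Rn.

Lemma lebesgue_Rn_box (R : realType) (N : nat) (a b : 'I_N -> R) :
  (forall i, a i <= b i) ->
  lebesgue_Rn [set x : Rn R N | forall i, a i <= x ord0 i <= b i] =
  (\prod_(i < N) (b i - a i))%:E.
Proof.
pose box n (a b : 'I_n -> R) : set (borelRn R n) :=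
  [set x | forall i, a i <= x ord0 i <= b i].
suff main n (c d : 'I_n -> R) : (forall i, c i <= d i) ->
    borel_lebesgue R n (box n c d) = (\prod_(i < n) (d i - c i))%:E /\
    measurable (box n c d).
  move=> ab; have [boxE mbox] := main N a b ab.
  by rewrite -boxE; exact: measurable_mu_extE.
elim: n c d => [|n IH] c d cd.
  rewrite (_ : box _ _ _ = setT); first by split => //; rewrite big_ord0 /= diracT.
  by apply/seteqP; split => // x _ [].
have [IH1 IH2] := IH (c \o lift ord0) (d \o lift ord0) (fun i => cd _).
have E : box n.+1 c d = @unconsRn R n @^-1`
    (`[c ord0, d ord0]%classic `*` box n (c \o lift ord0) (d \o lift ord0)).
  apply/seteqP; split => [x h|x [/= h1 h2] i].
    by split; [rewrite /= in_itv /=; exact: h | move=> i /=; rewrite mxE; exact: h].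
  have [j ->|->] := unliftP ord0 i; last by move: h1; rewrite in_itv.
  by have := h2 j; rewrite mxE.
split; last first.
  rewrite E -[X in measurable X]setTI; apply: measurable_unconsRn => //.
  exact: measurableX.
rewrite /= /lebesgue_cons /pushforward E -comp_preimage.
rewrite (_ : _ \o _ = id); last by apply/funext => z; exact: consRnK.
rewrite preimage_id product_measure1E// IH1 big_ord_recl EFinM.
congr (_ * _)%E.
apply: etrans (lebesgue_measure_itv `[c ord0, d ord0]) _; rewrite /= lte_fin.
by have := cd ord0; rewrite le_eqVlt => /orP[/eqP->|->//]; rewrite ltxx subrr.
Qed.

Arguments lebesgue_Rn : clear implicits.

Section euclidean.
Context (R : realType) (N : nat).
Implicit Types x y : Rn R N.

Definition dotRn x y : R := \sum_(i < N) x ord0 i * y ord0 i.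

(* The norm of 'rV[R]_N in the library is the sup norm. *)
Definition enorm x : R := Num.sqrt (dotRn x x).

(* Near each boundary point z, in a suitable direction e, Omega is the strict
   epigraph of a Lipschitz function gamma on the hyperplane orthogonal to e;
   x - dotRn x e *: e is the projection of x onto this hyperplane. *)
Definition lipschitz_boundary (Omega : set (Rn R N)) : Prop :=
  forall z, (closure Omega `\` interior Omega) z ->
  exists (r : R) (e : Rn R N) (gamma : Rn R N -> R^o),
    [/\ 0 < r, enorm e = 1,
        [lipschitz gamma y | y in [set y | dotRn y e = 0]] &
        forall x, enorm (x - z) < r ->
          Omega x <-> gamma (x - dotRn x e *: e) < dotRn x e].

Definition bounded_lipschitz_domain (Omega : set (Rn R N)) : Prop :=
  [/\ Omega !=set0, open Omega, connected Omega, bounded_set Omega &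
      lipschitz_boundary Omega].

End euclidean.

Section neumann_problem.
Context (R : realType) (N : nat).
Local Notation leb := (lebesgue_Rn R N).
Implicit Types (Omega : set (Rn R N)) (s p : R) (f g u v : Rn R N -> R).

Definition in_Lp (D : set (Rn R N)) p f : Prop :=
  measurable_fun D f /\ (\int[leb]_(x in D) (`|f x| `^ p)%:E < +oo)%E.

(* At t = 0 the value is 0 whatever the convention for the power. *)
Definition Jp p (t : R) : R := `|t| `^ (p - 2) * t.

(* On the null set x = y the kernel is 0 by the convention 0^-1 = 0. *)
Definition frac_kernel s p (x y : Rn R N) : R :=
  (enorm (x - y) `^ (N%:R + p * s))^-1.

(* R^2N minus (C Omega)^2 *)
Definition cross_domain Omega : set (Rn R N * Rn R N) :=
  ~` (~` Omega `*` ~` Omega).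

Definition normXp Omega s p g u : \bar R :=
  (\int[leb]_(x in Omega) (`|u x| `^ p)%:E
   + \int[leb]_(x in ~` closure Omega) (`| `|g x| `^ p^-1 * u x | `^ p)%:E
   + \int[leb \x leb]_(z in cross_domain Omega)
       (`|u z.1 - u z.2| `^ p * frac_kernel s p z.1 z.2)%:E)%E.

Definition in_X Omega s p g u : Prop :=
  measurable_fun setT u /\ (normXp Omega s p g u < +oo)%E.

(* If the measurable integrand is not integrable on Omega, the value is infinite; so the
   equality neumann_op Omega s p u x = c%:E contains the integrability. *)
Definition neumann_op Omega s p u (x : Rn R N) : \bar R :=
  (\int[leb]_(y in Omega) (Jp p (u x - u y) * frac_kernel s p x y)%:E)%E.

Definition weak_solution Omega s p f g u : Prop :=
  in_X Omega s p g u /\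
  forall v, in_X Omega s p g v ->
    ((2^-1)%:E * \int[leb \x leb]_(z in cross_domain Omega)
        (Jp p (u z.1 - u z.2) * (v z.1 - v z.2)
         * frac_kernel s p z.1 z.2)%:E
     = \int[leb]_(x in Omega) (f x * v x)%:E
       + \int[leb]_(x in ~` closure Omega) (g x * v x)%:E)%E.

End neumann_problem.

(* Main.v *)
Require Import Defs.
From mathcomp Require Import all_boot all_order all_algebra.
From mathcomp Require Import all_classical all_reals all_analysis.
From mathcomp Require Import measurable_realfun lra.
Import Order.TTheory GRing.Theory Num.Theory.
Import numFieldNormedType.Exports.
Local Open Scope classical_set_scope.
Local Open Scope ring_scope.
Set Implicit Arguments.
Unset Strict Implicit.
Unset Printing Implicit Defensive.

(** The nonlocal normal derivative is read off from the weak formulation by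
    testing it with indicators of measurable sets [A] that stay away from
    [Omega].

    Write [K] for the kernel and [F (x, y) = Jp p (u x - u y) * K x y] for the
    flux density, an antisymmetric function.  If [A] is disjoint from [Omega]
    and [v] is its indicator, then [F (x, y) * (v x - v y)] is symmetric in [x]
    and [y], and on the complement of [C Omega * C Omega] it lives on the two
    mirror images [A * Omega] and [Omega * A], where it is [F] up to the mirror
    symmetry.  The factor [1/2] of the weak formulation thus compensates the
    two equal halves, and Fubini turns the left-hand side into the integral
    over [A] of the nonlocal normal derivative
    ([integral_cross_symmetric], [integral_rectangle]).  On the right-hand side
    the term with [f] vanishes because [v = 0] on [Omega], and the integral of
    [g] over [A] is left.  Hence the two sides of the Neumann condition have the
    same integral over [A] ([integral_neumann_op]), and since [A] is arbitrary
    they agree almost everywhere.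

    For integrability, [A] is taken inside some [far_part Omega n], the bounded
    part of space at distance at least [1 / (n + 1)] from [Omega].  There the
    kernel is bounded, so it is integrable on the finite-measure rectangle
    [A * Omega]; this puts the indicator in the space of test functions
    ([indic_in_X]) whatever the integrable datum [g] is.  Since
    [|t| ^ (p - 1) <= 1 + |t| ^ p] and [u] has finite energy, the flux density
    is integrable on [A * Omega] as well ([flux_integrable_far]).  The sets
    [far_part Omega n] exhaust the complement of [closure Omega]
    ([closureC_far_part]), and a countable union of null sets is null. *)

(** * Lebesgue measurability on R^N *)

Section lebesgue_measurability.
Context {R : realType} {N : nat}.
Implicit Types (x y : Rn R N) (A : set (Rn R N)).

Lemma measurable_coord (i : 'I_N) :
  measurable_fun setT (fun x : Rn R N => x ord0 i).
Proof.
move=> _ Y mY; apply: sub_caratheodory; apply: sub_sigma_algebra.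
exact: (@measurable_coordRn R N i measurableT Y mY).
Qed.

Lemma measurable_all_coord (P : 'I_N -> set R) :
  (forall i, measurable (P i)) ->
  measurable [set x : Rn R N | forall i, P i (x ord0 i)].
Proof.
move=> mP.
have -> : [set x : Rn R N | forall i, P i (x ord0 i)] =
    \bigcap_(i in [set: 'I_N]) (fun x : Rn R N => x ord0 i) @^-1` P i.
  by apply/seteqP; split => x h i; [move=> _; exact: h | exact: h].
apply: fin_bigcap_measurable => [|i _]; first exact: finite_finset.
by rewrite -[X in measurable X]setTI; exact: measurable_coord.
Qed.

(** Every open set is a countable union of cubes with rational centre and
    radius [1 / (k + 1)], and each cube is cut out by its coordinates. *)
Lemma open_Rn_measurable A : open A -> measurable A.
Proof.
move=> oA.
pose cube (q : 'rV[rat]_N * nat) := [set x : Rn R N |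
  forall i, `|ratr (q.1 ord0 i) - x ord0 i| < q.2.+1%:R^-1].
have -> : A = \bigcup_(q in [set: 'rV[rat]_N * nat])
    (if `[< cube q `<=` A >] then cube q else set0).
  apply/seteqP; split=> [x Ax|x [q _]]; last by case: asboolP => // + ?; apply.
  have [e /= e0 eA] : nbhs_ball x A by apply/nbhs_ballP; exact: open_nbhs_nbhs.
  (* Half of [e]: the cube has to contain [x] and still fit in [ball x e]. *)
  have /ltr_add_invr[k] : (0 : R) < e / 2 by rewrite divr_gt0.
  rewrite add0r => ke.
  have kgt0 : (0 : R) < k.+1%:R^-1 by rewrite invr_gt0.
  have /fin_all_exists[q xq] i : exists q : rat,
      `|ratr q - x ord0 i| < k.+1%:R^-1.
    have /rat_in_itvoo[q] : x ord0 i < x ord0 i + k.+1%:R^-1 by rewrite ltrDl.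
    rewrite in_itv/= => /andP[xq qx]; exists q.
    by rewrite ger0_norm ?subr_ge0 ?ltW// ltrBlDl.
  exists (\row_i q i, k) => //; case: asboolP => [_ i|[] y /= yq].
    by rewrite mxE; exact: xq.
  apply: eA; split=> // j i; rewrite [j]ord1 /ball/=.
  rewrite -(subrKA (ratr (q i))) (splitr e).
  apply: (le_lt_trans (ler_normD _ _)); apply: ltrD; apply: lt_trans ke.
    by rewrite distrC; exact: xq.
  by have := yq i; rewrite mxE.
apply: countable_bigcupT_measurable => [|q]; first exact: countableP.
case: asboolP => // _.
apply: (@measurable_all_coord
  (fun i => (fun t : R => `|ratr (q.1 ord0 i) - t|) @^-1` `]-oo, q.2.+1%:R^-1[)).
move=> i; rewrite -[X in measurable X]setTI.
have : measurable_fun setT (fun t : R => `|ratr (q.1 ord0 i) - t|).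
  by apply: measurableT_comp => //; apply: measurable_funB.
by apply => //; exact: measurable_itv.
Qed.

Lemma closed_Rn_measurable A : closed A -> measurable A.
Proof.
move=> cA; rewrite -(setCK A); apply: measurableC.
by apply: open_Rn_measurable; exact: closed_openC.
Qed.

Lemma measurable_enorm_sub :
  measurable_fun setT (fun z : Rn R N * Rn R N => enorm (z.1 - z.2)).
Proof.
(* Powers are known to be measurable, so the square root is written as one. *)
rewrite /enorm (_ : (fun z => _) =
  (fun t : R => t `^ 2^-1) \o (fun z : Rn R N * Rn R N =>
    dotRn (z.1 - z.2) (z.1 - z.2))); last first.
  apply/funext => z /=; rewrite powR12_sqrt// sumr_ge0// => i _.
  by rewrite -expr2 sqr_ge0.
apply: measurableT_comp => //; rewrite /dotRn; apply: measurable_sum => i.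
have mD : measurable_fun setT
    (fun z : Rn R N * Rn R N => (z.1 - z.2) ord0 i).
  under eq_fun do rewrite !mxE.
  apply: measurable_funB.
    exact: (measurableT_comp (measurable_coord i) measurable_fst).
  exact: (measurableT_comp (measurable_coord i) measurable_snd).
exact: measurable_funM.
Qed.

Lemma measurable_frac_kernel s p :
  measurable_fun setT (fun z : Rn R N * Rn R N => frac_kernel s p z.1 z.2).
Proof.
rewrite /frac_kernel; under eq_fun do rewrite -powRN.
apply: (@measurableT_comp _ _ _ _ _ _ (fun t : R => t `^ _)) => //.
exact: measurable_enorm_sub.
Qed.

Lemma frac_kernelC s p x y : frac_kernel s p x y = frac_kernel s p y x.
Proof.
rewrite /frac_kernel /enorm /dotRn; congr ((Num.sqrt _ `^ _)^-1).
by apply: eq_bigr => i _; rewrite !mxE -mulrNN !opprB.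
Qed.

Lemma coord_le_enorm x i : `|x ord0 i| <= enorm x.
Proof.
rewrite /enorm -sqrtr_sqr ler_wsqrtr// /dotRn (bigD1 i)//= -expr2 lerDl.
by apply: sumr_ge0 => j _; rewrite -expr2 sqr_ge0.
Qed.

Lemma coord_le_norm x i : `|x ord0 i| <= `|x|.
Proof.
rewrite [leRHS](mx_normrE (x : 'rV[R]_N)).
exact: (le_bigmax _ (fun ij => `|(x : 'rV[R]_N) ij.1 ij.2|) (ord0, i)).
Qed.

(** Balls are those of the sup norm, whereas the kernel depends on the
    Euclidean norm; this comparison bounds the kernel away from a ball. *)
Lemma norm_le_enorm x : `|x| <= enorm x.
Proof.
rewrite [leLHS](mx_normrE (x : 'rV[R]_N)); apply: bigmax_le => [|[j i] _ /=].
  exact: sqrtr_ge0.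
by rewrite [j]ord1; exact: coord_le_enorm.
Qed.

End lebesgue_measurability.

(** * Integration over rectangles and crosses *)

Section rectangle_integrals.
Context d (T : measurableType d) (R : realType).
Variable mu : {sigma_finite_measure set T -> \bar R}.
Local Open Scope ereal_scope.

Lemma integrable_cst_fin (S : measurableType d) (nu : {measure set S -> \bar R})
    (D : set S) (c : R) :
  measurable D -> nu D < +oo -> nu.-integrable D (cst c%:E).
Proof.
move=> mD Doo; apply/integrableP; split; first exact: measurable_cst.
by rewrite /= integral_cst// lte_mul_pinfty.
Qed.

Lemma integrable_swap (H : T * T -> \bar R) : (mu \x mu).-integrable setT H ->
  (mu \x mu).-integrable setT (fun z => H (z.2, z.1)).
Proof.
move=> iH; have mH := measurable_int _ iH.
apply/integrable21ltyP; first by apply: (measurableT_comp mH); exact: measurable_swap.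
by apply/(integrable12ltyP mu mu mH).
Qed.

(** Integrating the two coordinates in either order gives the same value, and
    the swap only exchanges the two iterated integrals. *)
Lemma integral_swap (H : T * T -> \bar R) : (mu \x mu).-integrable setT H ->
  \int[mu \x mu]_z H (z.2, z.1) = \int[mu \x mu]_z H z.
Proof.
move=> iH; rewrite -(integral12_prod_meas1 iH).
by rewrite -(integral21_prod_meas1 (integrable_swap iH)).
Qed.

Section rectangle.
Variables (A B : set T) (F : T * T -> \bar R).
Hypotheses (mA : measurable A) (mB : measurable B).
Hypothesis iF : (mu \x mu).-integrable (A `*` B) F.

Let iFT : (mu \x mu).-integrable setT (F \_ (A `*` B)).
Proof. exact/(integrable_mkcond F (measurableX mA mB)). Qed.

Let section_restrict :
  fubini_F mu (F \_ (A `*` B)) = (fun x => \int[mu]_(y in B) F (x, y)) \_ A.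
Proof.
apply/funext => x; rewrite /fubini_F patchE; case: ifPn => xA.
  rewrite [RHS]integral_mkcond; apply: eq_integral => y _.
  by rewrite !patchE in_setX xA.
by apply: integral0_eq => y _; rewrite patchE in_setX (negbTE xA).
Qed.

Lemma integrable_rectangle_section :
  mu.-integrable A (fun x => \int[mu]_(y in B) F (x, y)).
Proof.
by apply/(integrable_mkcond _ mA); rewrite -section_restrict; exact: integrable_fubini_F.
Qed.

Lemma integral_rectangle :
  \int[mu \x mu]_(z in A `*` B) F z = \int[mu]_(x in A) \int[mu]_(y in B) F (x, y).
Proof.
rewrite integral_mkcond [RHS]integral_mkcond -section_restrict.
by rewrite -integral12_prod_meas1.
Qed.

End rectangle.

(** The cross consists of the pairs with at least one coordinate in [B].  A
    symmetric [F] that vanishes when neither coordinate is in [A] only sees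
    the two disjoint rectangles [A `*` B] and [B `*` A] of the cross, which are
    mirror images of each other. *)
Lemma integral_cross_symmetric (A B : set T) (F : T * T -> \bar R) :
  measurable A -> measurable B -> A `&` B = set0 ->
  (forall x y, F (y, x) = F (x, y)) ->
  (forall x y, ~ A x -> ~ A y -> F (x, y) = 0) ->
  (mu \x mu).-integrable (A `*` B) F ->
  \int[mu \x mu]_(z in ~` (~` B `*` ~` B)) F z =
  \int[mu \x mu]_(z in A `*` B) F z + \int[mu \x mu]_(z in A `*` B) F z.
Proof.
move=> mA mB AB0 Fsym F0 iF; have mAB := measurableX mA mB.
have iH : (mu \x mu).-integrable setT (F \_ (A `*` B)) by exact/(integrable_mkcond F mAB).
have ADB x : A x -> B x -> False.
  by move=> Ax Bx; rewrite -[False]/(set0 x) -AB0.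
transitivity (\int[mu \x mu]_z
    ((F \_ (A `*` B)) z + (F \_ (A `*` B)) (z.2, z.1))); last first.
  rewrite integralD//; last exact: integrable_swap.
  by rewrite integral_swap// -integral_mkcond.
rewrite integral_mkcond; apply: eq_integral => -[x y] _.
rewrite !patchE !in_setX !in_setC !in_setX/= !in_setC.
have -> : point = 0 :> \bar R by [].
have Fdisj a b : a \notin A -> b \notin A -> F (a, b) = 0.
  by rewrite !notin_setE; exact: F0.
have ADBb a : (a \in A) && (a \in B) = false.
  by apply/negP => /andP[]; rewrite !inE; exact: ADB.
move: (ADBb x) (ADBb y) (Fdisj x y); rewrite negb_and !negbK (Fsym x y).
case: (x \in A); case: (x \in B); case: (y \in A); case: (y \in B) => //= _ _ Fxy;
  first [by rewrite adde0 | by rewrite add0e | by rewrite Fxy// adde0].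
Qed.

End rectangle_integrals.

(** * Exhaustion of the exterior by bounded sets at positive distance *)

Section distance_exhaustion.
Context {R : realType} {N : nat}.
Implicit Types (x y : Rn R N) (Omega : set (Rn R N)).

Definition box (a : R) : set (Rn R N) := [set x | forall i, x ord0 i \in `[- a, a]].

Lemma measurable_box a : measurable (box a).
Proof.
apply: (@measurable_all_coord R N (fun=> `[- a, a]%classic)) => i.
exact: measurable_itv.
Qed.

Lemma box_lty a : 0 <= a -> (lebesgue_Rn R N (box a) < +oo)%E.
Proof.
move=> a0; have := @lebesgue_Rn_box R N (fun=> - a) (fun=> a).
rewrite (_ : [set x : Rn R N | _] = box a); first by move=> ->; rewrite ?ltry// => i; lra.
by apply/seteqP; split => x h i; have := h i; rewrite in_itv.
Qed.

Lemma bounded_set_lty Omega : bounded_set Omega -> measurable Omega ->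
  (lebesgue_Rn R N Omega < +oo)%E.
Proof.
move=> /ex_strict_bound_gt0[M M0 OM] mO.
apply: (le_lt_trans _ (box_lty (ltW M0))); apply: le_measure; rewrite ?inE//.
  exact: measurable_box.
move=> x Ox i; rewrite in_itv/= -ler_norml; apply: le_trans (ltW (OM x Ox)).
exact: coord_le_norm.
Qed.

(** Cutting off at a distance bounds the singular kernel, cutting off at
    infinity makes the measure finite. *)
Definition far_part Omega (n : nat) : set (Rn R N) :=
  box n%:R `\` \bigcup_(y in Omega) ball y n.+1%:R^-1.

Lemma measurable_far_part Omega n : measurable (far_part Omega n).
Proof.
apply: measurableD; first exact: measurable_box.
by apply: open_Rn_measurable; apply: bigcup_open => y _; exact: ball_open.
Qed.

Lemma far_part_lty Omega n : (lebesgue_Rn R N (far_part Omega n) < +oo)%E.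
Proof.
apply: (le_lt_trans _ (@box_lty n%:R _)) => //; apply: le_measure; rewrite ?inE.
- exact: measurable_far_part.
- exact: measurable_box.
- exact: subDsetl.
Qed.

Lemma far_part_closureC Omega n : far_part Omega n `<=` ~` closure Omega.
Proof.
move=> x [_ xfar] /(_ (ball x n.+1%:R^-1))[|y [Oy xy]].
  by apply: nbhsx_ballx; rewrite invr_gt0.
by apply: xfar; exists y => //; exact: ball_sym.
Qed.

Lemma closureC_far_part Omega :
  ~` closure Omega `<=` \bigcup_n far_part Omega n.
Proof.
move=> x xO.
have [e /= e0 eO] : nbhs_ball x (~` closure Omega).
  by apply/nbhs_ballP; apply: open_nbhs_nbhs; split => //;
    exact/closed_openC/closed_closure.
have /ltr_add_invr[k] := e0; rewrite add0r => ke.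
pose m := Num.bound `|x|; exists (maxn k m) => //; split.
  move=> i; rewrite in_itv/= -ler_norml.
  apply: (@le_trans _ _ `|x|).
    exact: coord_le_norm.
  apply: (le_trans (ltW (archi_boundP (normr_ge0 _)))).
  by rewrite ler_nat leq_maxr.
move=> [y Oy yx]; apply: (eO y); last exact: subset_closure.
apply: le_ball (ball_sym yx); apply: le_trans (ltW ke).
by rewrite lef_pV2 ?posrE// ler_nat ltnS leq_maxl.
Qed.

Lemma far_part_enorm Omega n x y : far_part Omega n x -> Omega y ->
  n.+1%:R^-1 <= enorm (x - y).
Proof.
move=> [_ xfar] Oy; rewrite leNgt; apply/negP => xy; apply: xfar.
exists y => //; apply: ball_sym; rewrite (mx_norm_ball R 1 N)/ball_/=.
exact: le_lt_trans (norm_le_enorm _) xy.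
Qed.

Lemma far_part_kernel Omega n s p x y : 0 <= N%:R + p * s ->
  far_part Omega n x -> Omega y ->
  frac_kernel s p x y <= n.+1%:R `^ (N%:R + p * s).
Proof.
move=> a0 xfar Oy; have xy := far_part_enorm xfar Oy.
have n0 : (0 : R) < n.+1%:R^-1 by rewrite invr_gt0.
have xy0 : 0 < enorm (x - y) by exact: lt_le_trans xy.
rewrite /frac_kernel -[leLHS]mul1r ler_pdivrMr ?powR_gt0// -powRM ?(ltW xy0)//.
apply: (@le_trans _ _ (1 `^ (N%:R + p * s))); first by rewrite powR1.
rewrite ge0_ler_powR ?nnegrE//; first by rewrite mulr_ge0 ?(ltW xy0).
by rewrite mulrC -ler_pdivrMr// mul1r.
Qed.
End distance_exhaustion.

(** * Testing with indicators of sets far from the domain *)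

Section neumann_flux.
Context {R : realType} {N : nat}.
Local Notation leb := (lebesgue_Rn R N).
Implicit Types (A Omega : set (Rn R N)) (s p : R) (f g u : Rn R N -> R).

Lemma JpN p (t : R) : Jp p (- t) = - Jp p t.
Proof. by rewrite /Jp normrN mulrN. Qed.

(** [|Jp p t|] is [|t| ^ (p - 1)]: below [1] for [|t| <= 1], and below
    [|t| ^ p] otherwise. *)
Lemma norm_Jp_le p (t : R) : 1 < p -> `|Jp p t| <= 1 + `|t| `^ p.
Proof.
move=> p1; rewrite /Jp normrM ger0_norm ?powR_ge0//.
have [->|t0] := eqVneq t 0; first by rewrite normr0 mulr0 addr_ge0 ?powR_ge0.
rewrite -[X in _ * X]powRr1// -powRD; last by rewrite normr_eq0 t0 implybT.
have [t1|/ltW t1] := leP `|t| 1.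
  apply: (@le_trans _ _ 1); last by rewrite lerDl powR_ge0.
  apply: (@le_trans _ _ (1 `^ (p - 2 + 1))); last by rewrite powR1.
  by rewrite ge0_ler_powR ?nnegrE//; lra.
apply: (@le_trans _ _ (`|t| `^ p)); last by rewrite lerDr.
by rewrite ler_powR//; lra.
Qed.

Lemma measurable_diff u : measurable_fun setT u ->
  measurable_fun setT (fun z : Rn R N * Rn R N => u z.1 - u z.2).
Proof.
move=> mu; apply: measurable_funB.
  exact: (measurableT_comp mu measurable_fst).
exact: (measurableT_comp mu measurable_snd).
Qed.

Lemma measurable_norm_powR d (T : measurableType d) (D : set T) (h : T -> R) (q : R) :
  measurable_fun D h -> measurable_fun D (fun x => `|h x| `^ q).
Proof.
move=> mh; apply: (@measurableT_comp _ _ _ _ _ _ (fun t : R => t `^ q)) => //.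
exact: measurableT_comp.
Qed.

Lemma rectangle_sub_cross A Omega : A `*` Omega `<=` cross_domain Omega.
Proof. by move=> z [_ Oz] [_ nOz]. Qed.

Lemma measurable_cross_domain Omega :
  measurable Omega -> measurable (cross_domain Omega).
Proof.
by move=> mO; apply: measurableC; apply: measurableX; exact: measurableC.
Qed.

Lemma normXp_gagliardo_lty Omega s p g u : (normXp Omega s p g u < +oo)%E ->
  (\int[leb \x leb]_(z in cross_domain Omega)
     (`|u z.1 - u z.2| `^ p * frac_kernel s p z.1 z.2)%:E < +oo)%E.
Proof.
apply: le_lt_trans; rewrite /normXp leeDr// adde_ge0//;
  by apply: integral_ge0 => x _; rewrite lee_fin powR_ge0.
Qed.

Section far_rectangle.
Variables (Omega A : set (Rn R N)) (s p : R) (n : nat).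
Hypotheses (mO : measurable Omega) (Ooo : (leb Omega < +oo)%E).
Hypotheses (mA : measurable A) (Afar : A `<=` far_part Omega n).
Hypotheses (p1 : 1 < p) (s0 : 0 < s).

Let exponent_ge0 : 0 <= N%:R + p * s.
Proof. by rewrite addr_ge0// mulr_ge0 ?(ltW s0)// (le_trans _ (ltW p1)). Qed.

Let mAO : measurable (A `*` Omega).
Proof. exact: measurableX. Qed.

(** The kernel is bounded on this rectangle, which has finite measure. *)
Lemma frac_kernel_integrable_far :
  (leb \x leb)%E.-integrable (A `*` Omega)
    (fun z => (frac_kernel s p z.1 z.2)%:E).
Proof.
apply: (@le_integrable _ _ _ _ _ mAO _
    (cst (n.+1%:R `^ (N%:R + p * s))%:E)).
- by apply/measurable_EFinP; apply: measurable_funTS; exact: measurable_frac_kernel.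
- move=> [x y] [/= Ax Oy]; rewrite lee_fin !ger0_norm ?invr_ge0 ?powR_ge0//.
  by apply: far_part_kernel Oy => //; exact: Afar.
apply: integrable_cst_fin => //.
have Aoo : (leb A < +oo)%E.
  apply: le_lt_trans (far_part_lty Omega n); apply: le_measure; rewrite ?inE//.
  exact: measurable_far_part.
rewrite [ltLHS](product_measure1E leb leb mA mO).
by rewrite lte_mul_pinfty// ?ge0_fin_numE.
Qed.

(** By [norm_Jp_le] the flux density is dominated by the kernel plus the energy
    density of [u]. *)
Lemma flux_integrable_far u : measurable_fun setT u ->
  (\int[leb \x leb]_(z in cross_domain Omega)
     (`|u z.1 - u z.2| `^ p * frac_kernel s p z.1 z.2)%:E < +oo)%E ->
  (leb \x leb)%E.-integrable (A `*` Omega)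
    (fun z => (Jp p (u z.1 - u z.2) * frac_kernel s p z.1 z.2)%:E).
Proof.
move=> mu uoo; have mdu := measurable_diff mu.
have mK := measurable_frac_kernel (R := R) (N := N) s p.
have iu : (leb \x leb)%E.-integrable (A `*` Omega)
    (fun z => (`|u z.1 - u z.2| `^ p * frac_kernel s p z.1 z.2)%:E).
  apply: (@integrableS _ _ _ _ _ _ _ (measurable_cross_domain mO)) => //.
    exact: rectangle_sub_cross.
  apply/integrableP; split.
    apply/measurable_EFinP; apply: measurable_funTS; apply: measurable_funM => //.
    exact: measurable_norm_powR.
  under eq_integral do rewrite gee0_abs ?lee_fin ?mulr_ge0 ?invr_ge0 ?powR_ge0//.
  exact: uoo.
apply: (@le_integrable _ _ _ _ _ mAO _
    ((fun z => (frac_kernel s p z.1 z.2)%:E) \+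
     (fun z => (`|u z.1 - u z.2| `^ p * frac_kernel s p z.1 z.2)%:E))%E).
- apply/measurable_EFinP; apply: measurable_funTS; apply: measurable_funM => //.
  by apply: measurable_funM => //; exact: measurable_norm_powR.
- move=> z _ /=; rewrite lee_fin.
  have K0 : 0 <= frac_kernel s p z.1 z.2 by rewrite invr_ge0 powR_ge0.
  rewrite normrM (ger0_norm K0) [leRHS]ger0_norm.
    apply: (@le_trans _ _ ((1 + `|u z.1 - u z.2| `^ p) * frac_kernel s p z.1 z.2)).
      by rewrite ler_wpM2r// norm_Jp_le.
    by rewrite mulrDl mul1r.
  by rewrite addr_ge0// mulr_ge0// powR_ge0.
exact: integrableD frac_kernel_integrable_far iu.
Qed.

Let far_disjoint x : A x -> ~ Omega x.
Proof.
by move=> Ax Ox; apply: (far_part_closureC (Afar Ax)); exact: subset_closure.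
Qed.

Let far_disjoint0 : A `&` Omega = set0.
Proof. by apply/seteqP; split => // x [] /far_disjoint. Qed.

Let indic_rectangle (z : Rn R N * Rn R N) :
  (A `*` Omega) z -> \1_A z.1 - \1_A z.2 = 1 :> R.
Proof.
move=> [Az Oz]; rewrite !indicE (mem_set Az) memNset ?subr0//.
by move=> /far_disjoint.
Qed.

(** The [L^p] part of the norm vanishes because [A] misses [Omega], the weighted
    part is at most the integral of [|g|] (a weight whose [p]-th root is raised
    back to the power [p]), and the energy is twice the integral of the kernel
    over [A `*` Omega]. *)
Lemma indic_in_X g :
  leb.-integrable (~` closure Omega) (EFin \o g) ->
  in_X Omega s p g (\1_A).
Proof.
have p0 : p != 0 by rewrite gt_eqF// (lt_trans _ p1).
move=> /integrableP[/measurable_EFinP mg goo]; split; first exact: measurable_indic.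
rewrite /normXp [X in (X + _ + _)%E](_ : _ = 0%E); last first.
  apply: integral0_eq => x Ox; rewrite indicE memNset; last first.
    by move=> Ax; exact: (far_disjoint Ax).
  by rewrite normr0 powR0.
rewrite add0e; apply: lte_add_pinfty.
  have mC : measurable (~` closure Omega).
    by apply: measurableC; apply: closed_Rn_measurable; exact: closed_closure.
  apply: le_lt_trans goo; apply: (ge0_le_integral leb mC).
  - by move=> x _; rewrite lee_fin powR_ge0.
  - apply/measurable_EFinP; apply: measurable_norm_powR; apply: measurable_funM.
      exact: measurable_norm_powR.
    exact: measurable_indic.
  - by apply: measurableT_comp => //; exact/measurable_EFinP.
  move=> x _; rewrite lee_fin indicE; case: (x \in A); last first.
    by rewrite mulr0 normr0 powR0.
  by rewrite mulr1 (ger0_norm (powR_ge0 _ _)) -powRrM mulVf// powRr1.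
have iK : (leb \x leb)%E.-integrable (A `*` Omega)
    (fun z => (`|\1_A z.1 - \1_A z.2| `^ p * frac_kernel s p z.1 z.2)%:E).
  apply: eq_integrable frac_kernel_integrable_far => //.
  by move=> z /[!inE] zAO; rewrite indic_rectangle// normr1 powR1 mul1r.
rewrite (integral_cross_symmetric mA mO far_disjoint0 _ _ iK).
- have /integrableP[_] := iK.
  under eq_integral do
    rewrite gee0_abs ?lee_fin ?mulr_ge0 ?invr_ge0 ?powR_ge0//.
  by move=> iKoo; exact: lte_add_pinfty.
- by move=> x y; rewrite /= distrC frac_kernelC.
- move=> x y xA yA; rewrite /= !indicE !memNset// subrr normr0 powR0//.
  by rewrite mul0r.
Qed.

(** This is the weak formulation tested with the indicator of [A]. *)
Lemma integral_neumann_op f g u :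
  leb.-integrable (~` closure Omega) (EFin \o g) ->
  weak_solution Omega s p f g u ->
  (\int[leb]_(x in A) neumann_op Omega s p u x = \int[leb]_(x in A) (g x)%:E)%E.
Proof.
move=> ig [[mu uoo]] /(_ _ (indic_in_X ig)).
have iF : (leb \x leb)%E.-integrable (A `*` Omega)
    (fun z => (Jp p (u z.1 - u z.2) * frac_kernel s p z.1 z.2)%:E).
  exact/flux_integrable_far/(normXp_gagliardo_lty uoo).
have iPhi : (leb \x leb)%E.-integrable (A `*` Omega)
    (fun z => (Jp p (u z.1 - u z.2) * (\1_A z.1 - \1_A z.2)
       * frac_kernel s p z.1 z.2)%:E).
  apply: eq_integrable iF => // z /[!inE] zAO.
  by rewrite indic_rectangle// mulr1.
rewrite (integral_cross_symmetric mA mO far_disjoint0 _ _ iPhi); last 2 first.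
- by move=> x y; rewrite /= -opprB JpN -[\1_A y - _]opprB mulrNN frac_kernelC.
- move=> x y xA yA; rewrite /= !indicE !memNset// subrr.
  by rewrite mulr0 mul0r.
have -> : (\int[leb]_(x in Omega) (f x * \1_A x)%:E = 0)%E.
  apply: integral0_eq => x Ox; rewrite indicE memNset ?mulr0//.
  by move=> Ax; exact: (far_disjoint Ax).
have -> : (\int[leb]_(x in ~` closure Omega) (g x * \1_A x)%:E =
    \int[leb]_(x in A) (g x)%:E)%E.
  rewrite integral_mkcond [RHS]integral_mkcond; apply: eq_integral => x _.
  rewrite !patchE indicE; case: (boolP (x \in A)) => [|_]; last first.
    by rewrite mulr0; case: ifP.
  rewrite inE => Ax; rewrite mulr1 mem_set//; exact: far_part_closureC (Afar Ax).
rewrite add0e => <-.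
have -> : (\int[leb \x leb]_(z in A `*` Omega)
      (Jp p (u z.1 - u z.2) * (\1_A z.1 - \1_A z.2)
         * frac_kernel s p z.1 z.2)%:E =
    \int[leb]_(x in A) neumann_op Omega s p u x)%E.
  rewrite -(integral_rectangle mA mO iF); apply: eq_integral => z /[!inE] zAO.
  by rewrite indic_rectangle// mulr1.
have /fineK <- := integrable_fin_num mA (integrable_rectangle_section mA mO iF).
by rewrite -EFinD -EFinM; congr EFin; lra.
Qed.

End far_rectangle.
End neumann_flux.

(** * The Neumann condition *)

Theorem theorem2p8 (R : realType) (N : nat) (Omega : set (Rn R N)) (s p : R)
    (f g u : Rn R N -> R) :
  (1 <= N)%N -> bounded_lipschitz_domain Omega ->
  1 < p -> 0 < s < 1 ->
  in_Lp Omega (p / (p - 1)) f ->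
  (lebesgue_Rn R N).-integrable (~` closure Omega) (EFin \o g) ->
  weak_solution Omega s p f g u ->
  {ae (lebesgue_Rn R N), forall x, (~` closure Omega) x ->
    neumann_op Omega s p u x = (g x)%:E}.
Proof.
move=> _ [_ /open_Rn_measurable mO _ bO _] p1 /andP[s0 _] _ ig usol.
have Ooo := bounded_set_lty bO mO.
have mC : measurable (~` closure Omega).
  by apply: measurableC; apply: closed_Rn_measurable; exact: closed_closure.
suff far n : ae_eq (lebesgue_Rn R N) (far_part Omega n)
    (neumann_op Omega s p u) (EFin \o g).
  apply: filterS (ae_foralln far) => x xfar /closureC_far_part[n _].
  exact: xfar.
have mfar := measurable_far_part Omega n.
apply: integral_ae_eq => //.
- have [[mu uoo] _] := usol.
  exact: (integrable_rectangle_section mfar mO (flux_integrable_far mO Ooo mfar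
    (@subset_refl _ _) p1 s0 mu (normXp_gagliardo_lty uoo))).
- apply: measurable_funS (measurable_int _ ig) => //.
  exact: far_part_closureC.
- move=> A Afar mA.
  exact: (integral_neumann_op mO Ooo mA Afar p1 s0 ig usol).
Qed.
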